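(* Let $n,d\ge 1$ be integers, let $\mathcal{B}=(l_1,u_1,\dots,l_d,u_d)$ be a bounding family, and let $\mathcal{D}=\prod_{r=1}^d\mathcal{D}_r$ be a product distribution on $[n]^d$. For every $\varepsilon>0$ there is a tester for the property $\mathcal{P}(\mathcal{B})$ with respect to $\mathcal{D}$ (for functions $f:[n]^d\to\mathbb{R}$) with proximity parameter $\varepsilon$ that makes $100\,\varepsilon^{-1}\Delta^*(\mathcal{D})$ queries.
   Context: $[k]=\{1,\dots,k\}$ and $\mathbf{e}_r$ is the $r$-th unit vector. A bounding family is a tuple of $2d$ functions $l_1,u_1,\dots,l_d,u_d:[n-1]\to\mathbb{R}$ with $l_r(y)<u_r(y)$ for all $r\in[d]$, $y\in[n-1]$. The property $\mathcal{P}(\mathcal{B})$ is the set of $f:[n]^d\to\mathbb{R}$ such that $l_r(x_r)\le f(x+\mathbf{e}_r)-f(x)\le u_r(x_r)$ for all $r\in[d]$ and all $x\in[n]^d$ with $x_r<n$. For a distribution $\mathcal{D}$ on $[n]^d$, $\mathrm{dist}_{\mathcal{D}}(f,g)=\Pr_{x\sim\mathcal{D}}[f(x)\ne g(x)]$ and $\mathrm{dist}_{\mathcal{D}}(f,\mathcal{P})=\inf_{g\in\mathcal{P}}\mathrm{dist}_{\mathcal{D}}(f,g)$. A tester for $\mathcal{P}$ w.r.t. $\mathcal{D}$ with proximity parameter $\varepsilon$ knows $\mathcal{D}$, has query access to $f$, accepts with probability $>2/3$ if $f\in\mathcal{P}$, and rejects with probability $>2/3$ if $\mathrm{dist}_{\mathcal{D}}(f,\mathcal{P})>\varepsilon$.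 For a binary search tree (BST) $T$ on the totally ordered universe $[n]$, the depth of a node is the number of edges from it to the root; for a distribution $\mathcal{D}_r$ on $[n]$, $\Delta^*(\mathcal{D}_r)$ is the minimum over all BSTs $T$ on $[n]$ of $\mathbb{E}_{v\sim\mathcal{D}_r}[\mathrm{depth}_T(v)]$, and for a product distribution $\Delta^*(\mathcal{D})=\sum_{r=1}^d\Delta^*(\mathcal{D}_r)$. *)

(* Defs.v *)
From HB Require Import structures.
From mathcomp Require Import all_boot all_order all_algebra.
From mathcomp Require Import boolp classical_sets reals.
From Stdlib Require List.
Set Implicit Arguments. Unset Strict Implicit. Unset Printing Implicit Defensive.
Import Order.TTheory GRing.Theory Num.Theory.
Local Open Scope ring_scope.
Local Open Scope classical_set_scope.

(* Conventions (0-based): [n] is represented by 'I_n = {0,...,n-1},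
   coordinates [d] by 'I_d; a point of [n]^d is a finite function 'I_d -> 'I_n. *)
Definition point (n d : nat) := {ffun 'I_d -> 'I_n}.

Definition shift n d (x : point n d) (r : 'I_d) (h : ((x r).+1 < n)%N) : point n d :=
  [ffun j => if j == r then Ordinal h else x j].

(* bounding family: l r, u r : [n-1] -> R, given as functions on nat of which
   only the values at y with y.+1 < n (i.e. y in {0..n-2} ~ [n-1]) matter. *)
Definition bounding_family (R : realType) (n d : nat) (l u : 'I_d -> nat -> R) :=
  forall (r : 'I_d) (y : nat), (y.+1 < n)%N -> l r y < u r y.

Definition inP (R : realType) n d (l u : 'I_d -> nat -> R) (f : point n d -> R) :=
  forall (r : 'I_d) (x : point n d) (h : ((x r).+1 < n)%N),
    l r (x r) <= f (shift h) - f x <= u r (x r).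

Definition is_distr (R : realType) n (p : {ffun 'I_n -> R}) :=
  (forall i, 0 <= p i) /\ \sum_i p i = 1.

Definition prodD (R : realType) n d (D : 'I_d -> {ffun 'I_n -> R}) (x : point n d) : R :=
  \prod_(r < d) D r (x r).

Definition distD (R : realType) n d (D : 'I_d -> {ffun 'I_n -> R})
  (f g : point n d -> R) : R :=
  \sum_(x : point n d | f x != g x) prodD D x.

Definition distP (R : realType) n d (D : 'I_d -> {ffun 'I_n -> R})
  (l u : 'I_d -> nat -> R) (f : point n d -> R) : R :=
  inf [set distD D f g | g in [set g | inP l u g]].

Inductive bst := BLeaf | BNode of bst & nat & bst.

Fixpoint inorder (t : bst) : seq nat :=
  match t with BLeaf => [::] | BNode a k b => inorder a ++ k :: inorder b end.

(* t is a BST whose key set is exactly [n] (in-order traversal = 0,1,...,n-1) *)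
Definition bst_on (n : nat) (t : bst) := inorder t = iota 0 n.

Fixpoint depth (t : bst) (v : nat) : nat :=
  match t with
  | BLeaf => 0
  | BNode a k b => if v == k then 0%N
                   else if (v < k)%N then (depth a v).+1 else (depth b v).+1
  end.

Definition exp_depth (R : realType) n (p : {ffun 'I_n -> R}) (t : bst) : R :=
  \sum_(v : 'I_n) p v * (depth t v)%:R.

Definition Delta1 (R : realType) n (p : {ffun 'I_n -> R}) : R :=
  inf [set exp_depth p t | t in [set t | bst_on n t]].

Definition DeltaD (R : realType) n d (D : 'I_d -> {ffun 'I_n -> R}) : R :=
  \sum_(r < d) Delta1 (D r).

(* deterministic adaptive query algorithm: query a point, branch on the
   real value received, finally output accept (true) / reject (false) *)
Inductive qtree (X A : Type) :=
  | QOut of bool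
  | QAsk of X & (A -> qtree X A).

Fixpoint run (X A : Type) (t : qtree X A) (f : X -> A) : bool :=
  match t with QOut b => b | QAsk x k => run (k (f x)) f end.

Fixpoint at_most_queries (X A : Type) (q : nat) (t : qtree X A) : Prop :=
  match t with
  | QOut _ => True
  | QAsk _ k => match q with 0 => False | q'.+1 => forall a, at_most_queries q' (k a) end
  end.

(* randomized tester = probability distribution (finitely supported) over
   deterministic query algorithms, each making at most q queries *)
Notation rtester R n d := (seq (R * qtree (point n d) R)%type).

Definition valid_tester (R : realType) n d (q : nat) (T : rtester R n d) :=
  [/\ forall p, Stdlib.Lists.List.In p T -> 0 <= p.1,
      \sum_(p <- T) p.1 = 1
    & forall p, Stdlib.Lists.List.In p T -> at_most_queries q p.2].

Definition acc_prob (R : realType) n d (T : rtester R n d) (f : point n d -> R) : R :=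
  \sum_(p <- T) p.1 * (run p.2 f)%:R.

Definition is_tester (R : realType) n d (D : 'I_d -> {ffun 'I_n -> R})
  (l u : 'I_d -> nat -> R) (eps : R) (T : rtester R n d) :=
  (forall f, inP l u f -> acc_prob T f > 2/3) /\
  (forall f, distP D l u f > eps -> 1 - acc_prob T f > 2/3).

(* Main.v *)
(* Let [m x y] be the quasimetric for which [f] has the property iff
   [f x - f y <= m x y] for all [x], [y].

   Tester: pick [x] from [D], a coordinate [r] and a proper ancestor [w] of
   [x r] in an optimal search tree for [D r], each with probability
   [D x / Delta], and compare [f] at [x] and at [x] with [x r] replaced by [w].
   Two points of an [r]-line have a common ancestor between them (their lowest
   one), so once the points [S r] in violation with some ancestor are removed no
   violation is left on [r]-lines; hence the rejection probability is at least
   [(sum_r D (S r)) / Delta].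

   It remains to bound the distance by [8 * sum_r D (S r)].  Let [V k t] be the
   least L1 cost of correcting [f] so that [g x - g y <= m x y + t] for all pairs
   agreeing on the first [k] coordinates, and let [K k = V k 0 - V k t].  For
   [t] below all violations, moving a good function by [t / 2] towards [f] gives
   [K 0 >= t / 2 * dist], while [K d = 0].  If [f] has no violation on [k]-lines,
   near-optimal corrections of the layers can be glued, so
   [V k 0 = V k.+1 0] and [K k <= K k.+1] because [V k.+1 t <= V k t]; and
   changing [f] on a set [S] changes [K k] by at most [2 t D(S)].  Thus
   [K k <= K k.+1 + 4 t D (S k)], and the sum over [k] is the claim. *)
Require Import Defs.
From HB Require Import structures.
From mathcomp Require Import all_boot all_order all_algebra.
From mathcomp Require Import boolp classical_sets reals.
From mathcomp Require Import ring lra zify.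
Set Implicit Arguments. Unset Strict Implicit. Unset Printing Implicit Defensive.
Import Order.TTheory GRing.Theory Num.Theory.
Local Open Scope ring_scope.

(** * Truncation of real numbers *)

Ltac minmax_lra :=
  repeat match goal with |- context [Order.min ?a ?b] => case: (lerP a b) => ? end;
  repeat match goal with |- context [Order.max ?a ?b] => case: (lerP a b) => ? end;
  repeat match goal with
  | |- context [`|?a|] => case: (ger0P a) => ?
  end; lra.

Section Clamp.
Variable R : realType.
Implicit Types a b x f g h : R.

Definition clamp a b x := Num.max a (Num.min x b).

Variant clamp_spec a b x : R -> Prop :=
| ClampLow of x <= a : clamp_spec a b x a
| ClampMid of a <= x & x <= b : clamp_spec a b x x
| ClampHigh of b <= x : clamp_spec a b x b.

Lemma clampP a b x : a <= b -> clamp_spec a b x (clamp a b x).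
Proof.
by rewrite /clamp => ab; case: (lerP x b) => h; case: lerP => h'; constructor; lra.
Qed.

(** Both pairs have the same sum and [h] lies between [g] and [g'], so convexity of the distance to
    [f] applies. *)
Lemma dist_swap f g g' h : Num.min g g' <= h <= Num.max g g' ->
  `|f - h| + `|f - (g + g' - h)| <= `|f - g| + `|f - g'|.
Proof.
wlog gg' : g g' / g <= g' => [hw|].
  have [le|le] := orP (le_total g g'); first exact: hw.
  by rewrite minC maxC [g + g']addrC [`|f - g| + _]addrC; exact: hw.
by rewrite min_l // max_r // => /andP[? ?]; minmax_lra.
Qed.

End Clamp.

(** * Quasimetrics and L1-best corrections *)

Section QuasiMetric.
Variables (R : realType) (X : finType) (e : rel X) (m : X -> X -> R).

Definition good (t : R) (g : X -> R) := forall x y, e x y -> g x - g y <= m x y + t.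

Lemma good_min t g h : good t g -> good t h -> good t (fun x => Num.min (g x) (h x)).
Proof. by move=> Hg Hh x y /[dup] /Hg + /Hh; minmax_lra. Qed.

Lemma good_max t g h : good t g -> good t h -> good t (fun x => Num.max (g x) (h x)).
Proof. by move=> Hg Hh x y /[dup] /Hg + /Hh; minmax_lra. Qed.

Lemma good_add t g c : good t g -> good t (fun x => g x + c).
Proof. by move=> Hg x y /Hg; lra. Qed.

Hypotheses (e_refl : reflexive e) (e_trans : transitive e).
Hypotheses (m_id : forall x, m x x = 0).
Hypothesis (m_tri : forall x y z, m x z <= m x y + m y z).

(* The McShane extension: the largest good function below [F]. *)
Definition mcshane (F : X -> R) (x : X) : R :=
  \big[Num.min/F x]_(y | e x y) (F y + m x y).

Lemma mcshane_le F x y : e x y -> mcshane F x <= F y + m x y.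
Proof. exact: bigmin_le_cond. Qed.

Lemma mcshane_le_id F x : mcshane F x <= F x.
Proof. exact: bigmin_le_id. Qed.

Lemma le_mcshane F x c : (forall y, e x y -> c <= F y + m x y) -> c <= mcshane F x.
Proof.
move=> H; apply: le_bigmin => //.
by have := H x (e_refl x); rewrite m_id addr0.
Qed.

Lemma mcshane_good F : good 0 (mcshane F).
Proof.
move=> x x' exx'; rewrite addr0 lerBlDl -lerBlDr; apply: le_mcshane => y ex'y.
have := mcshane_le F (e_trans exx' ex'y); have := m_tri x x' y; lra.
Qed.

(** With [mcshane_le_id], this puts a good function within [t] of [g]: the band used in
    [best_exchange]. *)
Lemma mcshane_slack t g x : good t g -> g x - t <= mcshane g x.
Proof. by move=> Hg; apply: le_mcshane => y /Hg; lra. Qed.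

Lemma mcshane_extend (A : pred X) f :
  (forall x y, A x -> A y -> e x y -> f x - f y <= m x y) ->
  exists2 g, good 0 g & forall x, A x -> g x = f x.
Proof.
(* [B] is so large that points outside [A] never lower the extension on [A]. *)
move=> HA; pose B := \sum_x `|f x| + \sum_x \sum_y `|m x y|.
have HB x y : f x <= B + m x y.
  have h1 : `|f x| <= \sum_x `|f x|.
    by rewrite (bigD1 x) //= lerDl sumr_ge0.
  have h2 : `|m x y| <= \sum_x \sum_y `|m x y|.
    rewrite (bigD1 x) //= (bigD1 y) //= -addrA lerDl addr_ge0 ?sumr_ge0 // => i _.
    by rewrite sumr_ge0.
  have := ler_norm (f x); have := ler_norm (- m x y); rewrite normrN /B; lra.
pose F x := if A x then f x else B.
exists (mcshane F); first exact: mcshane_good.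
move=> x Ax; apply/eqP; rewrite eq_le; apply/andP; split.
  by have := mcshane_le_id F x; rewrite /F Ax.
apply: le_mcshane => y exy; rewrite /F; case: ifP => Ay; last exact: HB.
by have := HA _ _ Ax Ay exy; lra.
Qed.

End QuasiMetric.

Section Cost.
Variables (R : realType) (X : finType) (D : X -> R).
Hypothesis (D_ge0 : forall x, 0 <= D x).
Definition cost (f g : X -> R) : R := \sum_x D x * `|f x - g x|.

Lemma cost_ge0 f g : 0 <= cost f g.
Proof. by apply: sumr_ge0 => x _; rewrite mulr_ge0. Qed.

Lemma costxx f : cost f f = 0.
Proof. by rewrite /cost big1 // => x _; rewrite subrr normr0 mulr0. Qed.

Variables (e : rel X) (m : X -> X -> R).
Hypotheses (e_refl : reflexive e) (e_trans : transitive e).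
Hypotheses (m_id : forall x, m x x = 0).
Hypothesis (m_tri : forall x y z, m x z <= m x y + m y z).

Definition best (f : X -> R) (t : R) : R := inf [set cost f g | g in [set g | good e m t g]].

Lemma good_slack s t g : s <= t -> good e m s g -> good e m t g.
Proof. by move=> st H x y /H; lra. Qed.

Lemma has_inf_best f t : 0 <= t -> has_inf [set cost f g | g in [set g | good e m t g]].
Proof.
move=> t0; split.
  exists (cost f (mcshane e m f)), (mcshane e m f) => //=.
  by apply: (good_slack t0); exact: mcshane_good.
by exists 0 => _ [g _ <-]; exact: cost_ge0.
Qed.

Lemma best_le f t g : good e m t g -> best f t <= cost f g.
Proof.
move=> Hg; apply: ge_inf; last by exists g.
by exists 0 => _ [? _ <-]; exact: cost_ge0.
Qed.

Lemma le_best f t c : 0 <= t -> (forall g, good e m t g -> c <= cost f g) -> c <= best f t.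
Proof.
move=> t0 H; apply: lb_le_inf; first by case: (has_inf_best f t0).
by move=> _ [g Hg <-]; exact: H.
Qed.

(* Modifying [f] on a set [S] changes the gain [best f 0 - best f t] by at most
   [2 t D(S)]: from competitors [g] for [(f, t)] and [g'] for [(f', 0)] one gets
   competitors [h] (the truncation of [g'] to a good band of width [t] around
   [g]) for [(f, 0)] and [g + g' - h] for [(f', t)].  Both lie between [g] and
   [g'], so off [S] the total cost does not increase. *)
Lemma best_exchange f f' (S : pred X) t : 0 <= t -> (forall x, ~~ S x -> f' x = f x) ->
  best f 0 + best f' t <= best f t + best f' 0 + 2 * t * \sum_(x | S x) D x.
Proof.
move=> t0 ff'.
suff H g g' : good e m t g -> good e m 0 g' ->
    best f 0 + best f' t <= cost f g + cost f' g' + 2 * t * \sum_(x | S x) D x.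
  set w := 2 * t * _ in H *.
  suff: best f 0 + best f' t - best f t - w <= best f' 0 by lra.
  apply: le_best => // g' Hg'.
  suff: best f 0 + best f' t - cost f' g' - w <= best f t by lra.
  by apply: le_best => // g Hg; have := H g g' Hg Hg'; lra.
move=> Hg Hg'; pose p := mcshane e m g.
have pg x : p x <= g x <= p x + t.
  rewrite mcshane_le_id /=; have := mcshane_slack e_refl m_id x Hg; rewrite /p; lra.
pose h x := clamp (p x) (p x + t) (g' x).
have Hp : good e m 0 p by exact: mcshane_good.
have Hh : good e m 0 h.
  by apply: good_max => //; apply: good_min => //; exact: good_add.
(* [g + g' - h] is [g] where the truncation is inactive and otherwise [g'] shifted by [g - p] or
   [g - p - t]. As [0 <= g - p <= t], every case follows from the bound for [g] or for [g']. *)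
have Hh' : good e m t (fun x => g x + g' x - h x).
  move=> x y exy; move: (pg x) (pg y) (Hg _ _ exy) (Hg' _ _ exy) => /andP[? ?] /andP[? ?].
  by rewrite /h; case: clampP; first lra; case: clampP; first lra; move=> *; lra.
have hg x : `|g x - h x| <= t.
  by move: (pg x) => /andP[? ?]; rewrite /h ler_norml; case: clampP; first lra; move=> *; lra.
apply: le_trans (lerD (best_le f Hh) (best_le f' Hh')) _.
rewrite /cost big_mkcond [X in _ * X]big_mkcond mulr_sumr -!big_split /=.
apply: ler_sum => x _.
have -> : 2 * t * (if S x then D x else 0) = D x * (if S x then 2 * t else 0).
  by case: ifP => _; rewrite ?mulr0 // mulrC.
rewrite -!mulrDr ler_wpM2l //; case: ifPn => [_|/ff' ->].
  (* On [S] the triangle inequalities through [g] and [g'] each lose [|g - h| <= t]. *)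
  have h1 := ler_distD (g x) (f x) (h x).
  have h2 := ler_distD (g' x) (f' x) (g x + g' x - h x).
  have := hg x; have : `|g' x - (g x + g' x - h x)| = `|g x - h x|.
    by rewrite distrC; congr `|_|; ring.
  by lra.
rewrite addr0; apply: dist_swap; move: (pg x) => /andP[? ?].
by rewrite /h; case: clampP; first lra; move=> *; minmax_lra.
Qed.

End Cost.

(** * The grid and product distributions *)

Section Grid.
Variables (R : realType) (n d : nat).
Local Notation grid := (Defs.point n d).
Implicit Types (x y z : grid) (r j : 'I_d) (a b : 'I_n).

Definition upd x r a : grid := [ffun j => if j == r then a else x j].

Lemma upd_same x r a : upd x r a r = a.
Proof. by rewrite ffunE eqxx. Qed.

Lemma upd_other x r a j : j != r -> upd x r a j = x j.
Proof. by rewrite ffunE => /negPf ->. Qed.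

Lemma upd_id x r : upd x r (x r) = x.
Proof. by apply/ffunP => j; rewrite ffunE; case: eqP => [->|]. Qed.

Lemma upd_upd x r a b : upd (upd x r a) r b = upd x r b.
Proof. by apply/ffunP => j; rewrite !ffunE; case: eqP. Qed.

Definition eqOn (P : pred 'I_d) x y := [forall j, P j ==> (x j == y j)].

Lemma eqOnP (P : pred 'I_d) x y : reflect (forall j, P j -> x j = y j) (eqOn P x y).
Proof.
by apply: (iffP forall_inP) => H j Pj; apply/eqP; [exact: H | rewrite H].
Qed.

Lemma eqOn_refl (P : pred 'I_d) : reflexive (eqOn P).
Proof. by move=> x; apply/eqOnP. Qed.

Lemma eqOn_trans (P : pred 'I_d) : transitive (eqOn P).
Proof.
move=> y x z /eqOnP xy /eqOnP yz; apply/eqOnP => j Pj.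
by rewrite xy // yz.
Qed.

Definition line r := eqOn (predC1 r).
(** [agree 0] relates all points and [agree d] only equal ones: the two ends of the induction on
    coordinates. *)
Definition agree (k : nat) := eqOn (fun j => (j < k)%N).

Lemma line_upd x r a : line r x (upd x r a).
Proof. by apply/eqOnP => j jr; rewrite upd_other. Qed.

Lemma upd_line x r a : line r (upd x r a) x.
Proof. by apply/eqOnP => j jr; rewrite upd_other. Qed.

Lemma lineE x y r : line r x y -> y = upd x r (y r).
Proof.
move=> /eqOnP H; apply/ffunP => j; rewrite ffunE.
by case: eqVneq => [->|/H].
Qed.

Lemma agree_upd x y r a : agree r x y -> agree r.+1 (upd x r a) (upd y r a).
Proof.
move=> /eqOnP H; apply/eqOnP => j jr; rewrite !ffunE; case: eqVneq => // neq.
by apply: H; rewrite ltn_neqAle -ltnS jr andbT.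
Qed.

Lemma agreeW x y k : agree k.+1 x y -> agree k x y.
Proof. by move=> /eqOnP H; apply/eqOnP => j jk; apply: H; rewrite ltnS ltnW. Qed.

Variables l u : 'I_d -> nat -> R.

(* When [u - l] is nonnegative below [n], the maximum is attained by the sum of
   [u] for [b <= a] and by minus the sum of [l] for [a <= b]; as a maximum of
   potential differences it satisfies the triangle inequality unconditionally. *)
Definition qm1 r (a b : nat) : R :=
  Num.max (\sum_(i < a) u r i - \sum_(i < b) u r i)
          (\sum_(i < a) l r i - \sum_(i < b) l r i).

Definition qm x y : R := \sum_r qm1 r (x r) (y r).

Lemma qm1_id r a : qm1 r a a = 0.
Proof. by rewrite /qm1 !subrr maxxx. Qed.

Lemma qm1_tri r (a b c : nat) : qm1 r a c <= qm1 r a b + qm1 r b c.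
Proof. by rewrite /qm1; minmax_lra. Qed.

Lemma qm_id x : qm x x = 0.
Proof. by rewrite /qm big1 // => r _; rewrite qm1_id. Qed.

Lemma qm_tri x y z : qm x z <= qm x y + qm y z.
Proof. by rewrite /qm -big_split /=; apply: ler_sum => r _; exact: qm1_tri. Qed.

Lemma qm_line x y r : line r x y -> qm x y = qm1 r (x r) (y r).
Proof.
move=> /eqOnP H; rewrite /qm (bigD1 r) //= big1 ?addr0 // => j jr.
by rewrite H // qm1_id.
Qed.

Lemma qm_upd x y r a b :
  qm (upd x r a) (upd y r b) + qm1 r (x r) (y r) = qm x y + qm1 r a b.
Proof.
rewrite /qm (bigD1 r) //= [in RHS](bigD1 r) //= !upd_same.
rewrite [in LHS](eq_bigr (fun j => qm1 j (x j) (y j))); first by ring.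
by move=> j jr; rewrite !upd_other.
Qed.

Variable D : 'I_d -> {ffun 'I_n -> R}.
Hypothesis D_distr : forall r, is_distr (D r).

Lemma prodD_ge0 x : 0 <= prodD D x.
Proof. by apply: prodr_ge0 => r _; case: (D_distr r). Qed.

Lemma sum_prodD : \sum_x prodD D x = 1.
Proof.
rewrite /prodD -(bigA_distr_bigA (fun r a => D r a)) big1 // => r _.
by case: (D_distr r).
Qed.

Lemma prodD_upd x r a : prodD D (upd x r a) * D r (x r) = prodD D x * D r a.
Proof.
rewrite /prodD (bigD1 r) //= [in RHS](bigD1 r) //= upd_same.
rewrite mulrAC [D r a * _]mulrC mulrAC; congr (_ * _ * _).
by apply: eq_bigr => j jr; rewrite upd_other.
Qed.

Lemma resample r (phi : grid -> R) :
  \sum_x prodD D x * phi x = \sum_a D r a * \sum_x prodD D x * phi (upd x r a).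
Proof.
transitivity (\sum_(p : grid * 'I_n) prodD D p.1 * D r p.2 * phi p.1).
  rewrite -(pair_bigA _ (fun x a => prodD D x * D r a * phi x)) /=.
  apply: eq_bigr => x _; under eq_bigr do rewrite mulrAC.
  by rewrite -mulr_sumr; case: (D_distr r) => _ ->; rewrite mulr1.
(* This involution swaps coordinate [r] with the fresh draw and preserves the joint weight. *)
pose h (p : grid * 'I_n) := (upd p.1 r p.2, p.1 r).
have hK : involutive h by move=> [x a]; rewrite /h /= upd_upd upd_id upd_same.
rewrite (reindex_inj (inv_inj hK)) /= -(pair_bigA _ (fun x a =>
  prodD D (upd x r a) * D r (x r) * phi (upd x r a))) exchange_big /=.
apply: eq_bigr => a _; rewrite mulr_sumr; apply: eq_bigr => x _.
by rewrite prodD_upd mulrA [D r a * _]mulrC.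
Qed.

(* If [f] has no violation along [r]-lines, near-optimal corrections of the
   layers [x r = a] can be glued by infimal convolution along [r]: comparing two
   layers, replacing [(h, g)] by [(min h (g + c), max g (h - c))] does not
   increase the total cost, and the second component is still a competitor. *)
Lemma best_line_good r f : good (line r) qm 0 f ->
  best (prodD D) (agree r) qm f 0 <= best (prodD D) (agree r.+1) qm f 0.
Proof.
move=> f_line; have D0 := prodD_ge0.
pose Q g := good (agree r.+1) qm 0 g.
pose C a g := cost (prodD D) (fun x => f (upd x r a)) (fun x => g (upd x r a)).
have C_ge0 a g : 0 <= C a g by exact: cost_ge0.
have costE g : cost (prodD D) f g = \sum_a D r a * C a g.
  by rewrite /cost (resample r).
apply: le_best => //; [exact: eqOn_refl | exact: eqOn_trans | exact: qm_id | exact: qm_tri |].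
move=> h Qh; apply/ler_addgt0Pr => eta eta0.
(* The [n] gluing steps and the near-optimality of [g] lose one [delta] each. *)
pose delta := eta / n.+1%:R.
have delta0 : 0 < delta by rewrite divr_gt0 ?ltr0n.
have /choice[G HG] a : exists g, Q g /\ forall k, Q k -> C a g <= C a k + delta.
  pose E := [set C a g | g in [set g | Q g]]%classic.
  have lbE : has_lbound E by exists 0 => _ [g _ <-].
  have [_ [g Qg <-] gE] : exists2 c, E c & c < inf E + delta.
    by apply: inf_adherent => //; split => //; exists (C a h), h.
  exists g; split=> // k Qk; apply: ltW; apply: (lt_le_trans gE).
  by rewrite lerD2r; apply: ge_inf => //; exists k.
(* [agree r.+1] never compares different layers, so the layerwise choices fit together. *)
pose g x := G (x r) x.
have Qg : Q g.
  move=> x y exy; have /eqOnP/(_ r (leqnn _)) exr := exy.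
  by rewrite /g exr; case: (HG (y r)) => + _; apply.
have Cg a k : Q k -> C a g <= C a k + delta.
  move=> Qk; have -> : C a g = C a (G a).
    by apply: eq_bigr => x _; rewrite /g upd_same.
  by case: (HG a) => _; apply.
(* Layers are glued one at a time; the default [g x] is the term of the layer of [x] itself. *)
pose gs s x := \big[Num.min/g x]_(b <- s) (g (upd x r b) + qm1 r (x r) b).
have Hgs s : Q (gs s) /\ forall a, C a (gs s) <= C a g + (size s)%:R * delta.
  elim: s => [|b s [Qs IH]].
    have gs0 : gs [::] = g by apply: funext => x; rewrite /gs big_nil.
    by rewrite gs0; split=> // a; rewrite mul0r addr0.
  pose g1 x := Num.min (g (upd x r b) + qm1 r (x r) b) (gs s x).
  have -> : gs (b :: s) = g1 by apply: funext => x; rewrite /gs /g1 big_cons.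
  split=> [|a].
    apply: good_min => // x y exy; have /eqOnP/(_ r (leqnn _)) exr := exy.
    have := Qg _ _ (agree_upd b (agreeW exy)); have := qm_upd x y r b b.
    by rewrite exr !qm1_id; lra.
  (* [k] competes with [g] on layer [b], so the swap costs at most one [delta] on layer [a]. *)
  pose k x := Num.max (g x) (gs s (upd x r a) - qm1 r a b).
  have Qk : Q k.
    apply: good_max => // x y exy; have /eqOnP/(_ r (leqnn _)) exr := exy.
    have := Qs _ _ (agree_upd a (agreeW exy)); have := qm_upd x y r a a.
    by rewrite exr !qm1_id; lra.
  have swap : C a g1 + C b k <= C a (gs s) + C b g.
    rewrite /C /cost -!big_split /=; apply: ler_sum => x _.
    rewrite -!mulrDr ler_wpM2l // /g1 /k !upd_upd !upd_same.
    have ab : line r (upd x r a) (upd x r b).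
      by rewrite -(upd_upd x r a b); exact: line_upd.
    have := f_line _ _ ab; rewrite (qm_line ab) !upd_same.
    (* With [c] added on layer [b], the swap pairs the smaller value with the smaller target, as
       [p <= q + c]. *)
    move: (f _) (f _) (gs s _) (g _) (qm1 _ _ _) => p q v w c pq.
    by minmax_lra.
  by have := IH a; have := Cg b k Qk; rewrite /= -natr1; lra.
have [_ Hcost] := Hgs (enum 'I_n).
pose g' := gs (enum 'I_n).
have Qg' : good (agree r) qm 0 g'.
  move=> x y exy.
  have H b : g' x - qm x y <= g (upd y r b) + qm1 r (y r) b.
    have h1 : g' x <= g (upd x r b) + qm1 r (x r) b.
      by apply: ge_bigmin_seq => //; rewrite mem_enum.
    have := Qg _ _ (agree_upd b exy); have := qm_upd x y r b b.
    have := qm1_tri r (x r) (y r) b; rewrite qm1_id; lra.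
  suff : g' x - qm x y <= g' y by lra.
  apply: le_bigmin => //.
  by have := H (y r); rewrite upd_id qm1_id addr0.
apply: le_trans (best_le D0 _ Qg') _.
rewrite !costE; apply: (@le_trans _ _ (\sum_a D r a * (C a h + eta))).
  apply: ler_sum => a _; apply: ler_wpM2l; first by case: (D_distr r).
  have := Hcost a; have := Cg a h Qh; rewrite size_enum_ord.
  have : eta = n.+1%:R * delta by rewrite /delta mulrC divfK // pnatr_eq0.
  by rewrite -natr1; lra.
under eq_bigr do rewrite mulrDr.
by rewrite big_split /= -mulr_suml; case: (D_distr r) => _ ->; rewrite mul1r.
Qed.

End Grid.

(** * Dimension reduction *)

Section DimensionReduction.
Variables (R : realType) (n d : nat) (l u : 'I_d -> nat -> R).
Variable D : 'I_d -> {ffun 'I_n -> R}.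
Hypothesis D_distr : forall r, is_distr (D r).
Local Notation grid := (Defs.point n d).
Local Notation best k := (best (prodD D) (agree (n:=n) (d:=d) k) (qm l u)).
Implicit Types (f g : grid -> R).

Let D_ge0 := prodD_ge0 D_distr.
Let agree_refl k := @eqOn_refl n d (fun j => (j < k)%N).
Let agree_trans k := @eqOn_trans n d (fun j => (j < k)%N).
Let qm_id := @qm_id R n d l u.
Let qm_tri := @qm_tri R n d l u.
Let le_best k := le_best D_ge0 (@agree_refl k) (@agree_trans k) qm_id qm_tri.
Let best_le k f t g (Hg : good (agree k) (qm l u) t g) := best_le D_ge0 f Hg.

Lemma best_agreeS k f t : 0 <= t -> best k.+1 f t <= best k f t.
Proof.
move=> t0; apply: le_best => // g Hg; apply: best_le => // x y /agreeW; exact: Hg.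
Qed.

(** Let [f'] equal [f] off [S] without violations on [r]-lines. Its gain does not drop from level
    [r] to [r.+1]; exchanging [f] and [f'] costs [2 t D(S)] at each level. *)
Lemma gain_step (r : 'I_d) (S : pred grid) f t : 0 <= t ->
  (forall x y, ~~ S x -> ~~ S y -> line r x y -> f x - f y <= qm l u x y) ->
  best r f 0 - best r f t <=
  best r.+1 f 0 - best r.+1 f t + 4 * t * \sum_(x | S x) prodD D x.
Proof.
move=> t0 HS.
have [f' f'_line f'f] := mcshane_extend (@eqOn_refl n d (predC1 r))
  (@eqOn_trans n d (predC1 r)) qm_id qm_tri (A := predC S) HS.
have f'f0 x : ~~ S x -> f' x = f x by exact: f'f.
have ff' x : ~~ S x -> f x = f' x by move/f'f.
have h1 := best_exchange D_ge0 (@agree_refl r) (@agree_trans r) qm_id qm_tri t0 f'f0.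
have h2 := best_exchange D_ge0 (@agree_refl r.+1) (@agree_trans r.+1) qm_id qm_tri t0 ff'.
have h3 := best_line_good D_distr f'_line.
have := best_agreeS r f' t0; lra.
Qed.

Lemma gain_last f t : 0 <= t -> best d f 0 - best d f t <= 0.
Proof.
move=> t0; have h1 : 0 <= best d f t by apply: le_best => // g _; exact: cost_ge0.
suff Hf : good (agree d) (qm l u) 0 f by have := best_le f Hf; rewrite costxx; lra.
move=> x y /eqOnP xy; have -> : x = y by apply/ffunP => j; exact: xy.
by have := qm_id y; lra.
Qed.

(* Below the smallest violation [t], a point moved by less than [t / 2] by a
   good function cannot be in violation with another such point. *)
Lemma gain_first f t delta : 0 < t ->
  (forall x y, qm l u x y < f x - f y -> qm l u x y + t <= f x - f y) ->
  (forall g, good (agree 0) (qm l u) 0 g -> delta <= distD D f g) ->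
  t / 2 * delta <= best 0 f 0 - best 0 f t.
Proof.
move=> t0 ft Hdelta.
suff : t / 2 * delta + best 0 f t <= best 0 f 0 by lra.
apply: le_best => // h Hh.
(* Moving [h] by at most [t / 2] at each point adds at most [t] of slack. *)
pose g x := clamp (h x - t / 2) (h x + t / 2) (f x).
have Hg : good (agree 0) (qm l u) t g.
  move=> x y /Hh; rewrite /g.
  by case: clampP; first lra; case: clampP; first lra; move=> *; lra.
pose A x := `|f x - h x| < t / 2.
have [g0 Hg0 g0f] : exists2 g0, good (agree 0) (qm l u) 0 g0 & forall x, A x -> g0 x = f x.
  apply: (mcshane_extend (@agree_refl 0) (@agree_trans 0) qm_id qm_tri).
  move=> x y; rewrite /A !ltr_norml => /andP[? ?] /andP[? ?] /Hh hxy.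
  rewrite leNgt; apply/negP => /ft; lra.
have h1 : delta <= \sum_(x | ~~ A x) prodD D x.
  apply: le_trans (Hdelta _ Hg0) _.
  rewrite /distD big_mkcond [leRHS]big_mkcond /=; apply: ler_sum => x _.
  case: eqVneq => [_|ne]; first by case: ifP.
  by case: ifPn => // /negPn /g0f E; rewrite E eqxx in ne.
(* Each point outside [A] saves exactly [t / 2] in the move from [h] to [g]. *)
have h2 : t / 2 * \sum_(x | ~~ A x) prodD D x <= cost (prodD D) f h - cost (prodD D) f g.
  rewrite /cost -sumrB big_mkcond mulr_sumr /=; apply: ler_sum => x _.
  rewrite -mulrBr.
  suff H : (if ~~ A x then t / 2 else 0) <= `|f x - h x| - `|f x - g x|.
    apply: le_trans (ler_wpM2l (D_ge0 x) H).
    by case: ifP => _; rewrite ?mulr0 // mulrC.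
  rewrite /A /g -leNgt; case: clampP => [|fx|fx xf|xf]; first lra.
  - by case: (lerP (t / 2)); minmax_lra.
  - by rewrite subrr normr0 subr0; case: (lerP (t / 2)).
  - by case: (lerP (t / 2)); minmax_lra.
have := best_le f Hg.
have : t / 2 * delta <= t / 2 * \sum_(x | ~~ A x) prodD D x by rewrite ler_wpM2l //; lra.
lra.
Qed.

(** The factor 8 is the loss [4 t] of [gain_step] over the rate [t / 2] of [gain_first]. *)
Theorem dimension_reduction (S : 'I_d -> pred grid) f delta :
  (forall r x y, ~~ S r x -> ~~ S r y -> line r x y -> f x - f y <= qm l u x y) ->
  (forall g, good (agree 0) (qm l u) 0 g -> delta <= distD D f g) ->
  delta <= 8 * \sum_r \sum_(x | S r x) prodD D x.
Proof.
move=> HS Hdelta.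
pose V (p : grid * grid) := qm l u p.1 p.2 < f p.1 - f p.2.
(* The default 1 keeps [t] positive when [f] has no violation. *)
pose t := \big[Num.min/1]_(p | V p) (f p.1 - f p.2 - qm l u p.1 p.2).
have t0 : 0 < t by apply: lt_bigmin => // p; rewrite /V; lra.
have ft x y : qm l u x y < f x - f y -> qm l u x y + t <= f x - f y.
  move=> xy; suff : t <= f x - f y - qm l u x y by lra.
  exact: (bigmin_le_cond _ (fun p => f p.1 - f p.2 - qm l u p.1 p.2) (j := (x, y))).
pose w r := \sum_(x | S r x) prodD D x.
have chain k : (k <= d)%N -> best 0 f 0 - best 0 f t <=
    best k f 0 - best k f t + 4 * t * \sum_(r < d | (r < k)%N) w r.
  elim: k => [_|k IH kd]; first by rewrite big_pred0 // mulr0 addr0.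
  have := gain_step (r := Ordinal kd) (ltW t0) (HS (Ordinal kd)).
  have := IH (ltnW kd).
  rewrite (bigD1 (Ordinal kd) (P := fun r : 'I_d => (r < k.+1)%N)) //=.
  rewrite [in X in _ -> _ -> X](eq_bigl (fun r : 'I_d => (r < k)%N)); last first.
    by move=> r; rewrite -val_eqE /= ltnS [RHS]ltn_neqAle andbC.
  rewrite -/(w (Ordinal kd)) mulrDr; lra.
have := chain d (leqnn d); have := gain_last f (ltW t0).
have := gain_first t0 ft Hdelta.
rewrite (eq_bigl xpredT) => [|r]; last by rewrite ltn_ord.
by move=> h1 h2 h3; rewrite -(ler_pM2l t0) -/w; lra.
Qed.

End DimensionReduction.

(** * The property as a quasimetric inequality *)

Section BoundedDerivative.
Variables (R : realType) (n d : nat) (l u : 'I_d -> nat -> R).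
Local Notation grid := (Defs.point n d).

(** Between neighbours, [l < u] makes the maximum in [qm1] equal to [u] going down and [- l] going
    up. *)
Lemma good_inP (g : grid -> R) : bounding_family n l u ->
  good (agree 0) (qm l u) 0 g -> inP l u g.
Proof.
move=> lu Hg r x h; have E : shift h = upd x r (Ordinal h) by [].
have agree0 (y z : grid) : agree 0 y z by apply/eqOnP.
have xs : line r x (shift h) by rewrite E line_upd.
have sx : line r (shift h) x by rewrite E upd_line.
have := Hg _ _ (agree0 x (shift h)); have := Hg _ _ (agree0 (shift h) x).
rewrite (qm_line _ _ xs) (qm_line _ _ sx) E upd_same /qm1 !big_ord_recr /=.
by have := lu r (x r) h; minmax_lra.
Qed.

(** The one-step bounds telescope along the line to one of the two arguments of the maximum in
    [qm1]. *)
Lemma inP_line (f : grid -> R) r x y : inP l u f -> line r x y -> f x - f y <= qm l u x y.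
Proof.
move=> Hf xy; rewrite (qm_line _ _ xy) (lineE xy) upd_same -{1}(upd_id x r).
have key k (a b : 'I_n) : (b = a + k :> nat)%N ->
  \sum_(i < b) l r i - \sum_(i < a) l r i <= f (upd x r b) - f (upd x r a)
  <= \sum_(i < b) u r i - \sum_(i < a) u r i.
  elim: k b => [|k IH] b; first by rewrite addn0 => /val_inj ->; rewrite !subrr lexx.
  rewrite addnS => bk; have h : ((a + k).+1 < n)%N by rewrite -bk.
  pose c := Ordinal (ltnW h); have := IH c erefl.
  have hc : ((upd x r c r).+1 < n)%N by rewrite upd_same.
  have := Hf r (upd x r c) hc; have -> : shift hc = upd x r b.
    apply/ffunP => j; rewrite ffunE; case: eqVneq => [->|jr]; last by rewrite !upd_other.
    by apply: val_inj; rewrite /= !upd_same bk.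
  by rewrite bk upd_same !big_ord_recr /=; lra.
rewrite /qm1 le_max; have [ab|ba] := leqP (x r) (y r).
  have /andP[? ?] := key (y r - x r)%N (x r) (y r) (esym (subnKC ab)).
  by apply/orP; right; lra.
have /andP[? ?] := key (x r - y r)%N (y r) (x r) (esym (subnKC (ltnW ba))).
by apply/orP; left; lra.
Qed.

End BoundedDerivative.

(** * Search trees *)

Fixpoint proper_ancestors (t : bst) (v : nat) : seq nat :=
  match t with
  | BLeaf => [::]
  | BNode a k b => if v == k then [::]
                   else k :: (if (v < k)%N then proper_ancestors a v else proper_ancestors b v)
  end.

Lemma size_proper_ancestors t v : size (proper_ancestors t v) = depth t v.
Proof.
by elim: t => //= a IHa k b IHb; case: eqP => // _; case: ifP => _ /=; rewrite ?IHa ?IHb.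
Qed.

Lemma mem_proper_ancestors t v w : w \in proper_ancestors t v -> w \in inorder t.
Proof.
elim: t => //= a IHa k b IHb; case: eqP => // _.
by rewrite mem_cat !inE => /orP[->|]; [rewrite orbT | case: ifP => _ => [/IHa|/IHb] ->; rewrite ?orbT].
Qed.

Lemma depth_le t v : (depth t v <= size (inorder t))%N.
Proof.
elim: t => //= a IHa k b IHb; rewrite size_cat /=.
case: eqP => // _; case: ifP => _; lia.
Qed.

(** Descend while both keys lie on the same side of the root; the first root that separates or meets
    them is [w]. *)
Lemma common_ancestor t u v : pairwise ltn (inorder t) ->
  u \in inorder t -> v \in inorder t -> (u <= v)%N ->
  exists w, [/\ (u <= w <= v)%N, w \in u :: proper_ancestors t u
              & w \in v :: proper_ancestors t v].
Proof.
elim: t => //= a IHa k b IHb; rewrite pairwise_cat /= => /and3P[/allrelP ab pa /andP[kb pb]].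
have a_lt w : w \in inorder a -> (w < k)%N by move=> wa; apply: ab; rewrite ?inE ?eqxx.
have b_gt w : w \in inorder b -> (k < w)%N by move: w; exact/allP.
rewrite !mem_cat !inE => hu hv uv.
have [uk|ku] := ltnP u k; last first.
  have [<-|nuk] := eqVneq u k.
    exists u; rewrite leqnn uv mem_head; split=> //.
    by case: (eqVneq v u) => [->|_]; rewrite !inE eqxx ?orbT.
  have kltu : (k < u)%N by rewrite ltn_neqAle eq_sym nuk.
  have kltv := leq_trans kltu uv.
  have ub : u \in inorder b.
    by case/or3P: hu => [/a_lt|/eqP E|//]; [rewrite ltnNge ku | rewrite E eqxx in nuk].
  have vb : v \in inorder b.
    case/or3P: hv => [/a_lt|/eqP E|//]; first by rewrite ltnNge (ltnW kltv).
    by rewrite E ltnn in kltv.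
  have [w [uwv wu wv]] := IHb pb ub vb uv; exists w.
  rewrite (gtn_eqF kltv) ltnNge (ltnW kltv) /=.
  by split=> //; [move: wu | move: wv]; rewrite !inE => /orP[] ->; rewrite ?orbT.
have [kv|vk] := leqP k v.
  exists k; rewrite (ltnW uk) kv (ltn_eqF uk); split=> //; first by rewrite !inE eqxx orbT.
  by case: eqVneq => [->|_]; rewrite !inE eqxx ?orbT.
have ua : u \in inorder a.
  by case/or3P: hu => [//|/eqP E|/b_gt]; [rewrite E ltnn in uk | rewrite ltnNge ltnW].
have va : v \in inorder a.
  by case/or3P: hv => [//|/eqP E|/b_gt]; [rewrite E ltnn in vk | rewrite ltnNge ltnW].
have [w [uwv wu wv]] := IHa pa ua va uv; exists w.
rewrite (ltn_eqF vk) (ltn_eqF uk).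
by split=> //; [move: wu | move: wv]; rewrite !inE => /orP[] ->; rewrite ?orbT.
Qed.

Lemma bst_on_exists n : exists t, bst_on n t.
Proof.
rewrite /bst_on; elim: n 0%N => [|n IH] m; first by exists BLeaf.
by have [t Ht] := IH m.+1; exists (BNode BLeaf m t); rewrite /= Ht.
Qed.

(** The cost depends only on the depth function, and depths are at most [n], so the infimum is a
    minimum over a finite type. *)
Lemma optimal_bst (R : realType) n (p : {ffun 'I_n -> R}) :
  exists2 t, bst_on n t & exp_depth p t <= Delta1 p.
Proof.
pose depths t : {ffun 'I_n -> 'I_n.+1} := [ffun v : 'I_n => inord (depth t v)].
pose P de := `[< exists2 t, bst_on n t & de = depths t >].
pose F (de : {ffun 'I_n -> 'I_n.+1}) : R := \sum_v p v * (de v)%:R.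
have FE t : bst_on n t -> F (depths t) = exp_depth p t.
  move=> tn; apply: eq_bigr => v _; rewrite ffunE inordK // ltnS.
  by apply: leq_trans (depth_le t v) _; rewrite tn size_iota.
have [t0 t0n] := bst_on_exists n.
have P0 : P (depths t0) by apply/asboolP; exists t0.
case: (arg_minP F P0) => de /asboolP[t tn ->] tmin.
exists t => //; apply: lb_le_inf; first by exists (exp_depth p t0), t0.
move=> _ [t' t'n <-]; rewrite -(FE _ tn) -(FE _ t'n).
by apply: tmin; apply/asboolP; exists t'.
Qed.

(** * Testers *)

Section Amplification.
Variables X A : Type.

Fixpoint andq (t1 t2 : qtree X A) : qtree X A :=
  match t1 with
  | QOut b => if b then t2 else QOut X A false
  | QAsk x k => QAsk x (fun a => andq (k a) t2)
  end.

Lemma run_andq t1 t2 f : run (andq t1 t2) f = run t1 f && run t2 f.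
Proof. by elim: t1 => [[]|x k IH] //=; rewrite IH. Qed.

Lemma at_most_queriesW q q' (t : qtree X A) :
  (q <= q')%N -> at_most_queries q t -> at_most_queries q' t.
Proof.
elim: t q q' => [b|x k IH] q q'; first by case: q'.
by case: q => // q; case: q' => // q' qq' H a; exact: (IH a q q' qq' (H a)).
Qed.

Lemma at_most_queries_andq q1 q2 t1 t2 :
  at_most_queries q1 t1 -> at_most_queries q2 t2 -> at_most_queries (q1 + q2) (andq t1 t2).
Proof.
move=> + H2; elim: t1 q1 => [b|x k IH] q1.
  by move=> _; case: b; [apply: at_most_queriesW H2; rewrite leq_addl | case: (q1 + q2)%N].
by case: q1 => // q1 H a; exact: (IH a q1 (H a)).
Qed.

End Amplification.

Lemma In_map (S T : Type) (f : S -> T) s y :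
  List.In y (map f s) -> exists2 x, List.In x s & y = f x.
Proof. by elim: s => //= x s IH [<-|/IH[z ? ->]]; [exists x; first left | exists z; first right]. Qed.

Lemma In_cat (T : Type) (s1 s2 : seq T) y :
  List.In y (s1 ++ s2) -> List.In y s1 \/ List.In y s2.
Proof. by elim: s1 => [|x s1 IH] /=; [right | move=> [->|/IH[]]; tauto]. Qed.

Lemma In_allpairs (S T U : Type) (f : S -> T -> U) s t z :
  List.In z [seq f x y | x <- s, y <- t] ->
  exists x y, [/\ List.In x s, List.In y t & z = f x y].
Proof.
elim: s => [//|x s IH] /= H; case: (In_cat H) => {}H.
  by have [y yt ->] := In_map H; exists x, y; split=> //; left.
by have [x' [y [x's yt ->]]] := IH H; exists x', y; split=> //; right.
Qed.

Section Testers.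
Variables (R : realType) (n d : nat).
Local Notation grid := (Defs.point n d).
Implicit Types (T : rtester R n d) (f : grid -> R).

(** Two independent runs: the product distribution. *)
Definition both T1 T2 : rtester R n d :=
  [seq (p.1 * p'.1, andq p.2 p'.2) | p <- T1, p' <- T2].

Lemma both_valid q1 q2 T1 T2 :
  valid_tester q1 T1 -> valid_tester q2 T2 -> valid_tester (q1 + q2) (both T1 T2).
Proof.
move=> [p1 s1 a1] [p2 s2 a2]; split.
- move=> p H; have [x [y [xT yT ->]]] := In_allpairs H.
  by apply: mulr_ge0; [exact: p1 | exact: p2].
- rewrite big_allpairs_dep /= -s1; apply: eq_bigr => p _.
  by rewrite -mulr_sumr s2 mulr1.
- move=> p H; have [x [y [xT yT ->]]] := In_allpairs H.
  by apply: at_most_queries_andq; [exact: a1 | exact: a2].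
Qed.

Lemma acc_prob_both T1 T2 f : acc_prob (both T1 T2) f = acc_prob T1 f * acc_prob T2 f.
Proof.
rewrite /acc_prob big_allpairs_dep mulr_suml /=; apply: eq_bigr => p _.
rewrite mulr_sumr; apply: eq_bigr => p' _.
by rewrite run_andq -mulnb natrM mulrACA.
Qed.

Definition accept_all : rtester R n d := [:: (1, QOut _ _ true)].

Lemma accept_all_valid q : valid_tester q accept_all.
Proof.
split; first by move=> p [<-|[]] /=.
  by rewrite big_cons big_nil addr0.
by move=> p [<-|[]]; case: q.
Qed.

Lemma acc_prob_accept_all f : acc_prob accept_all f = 1.
Proof. by rewrite /acc_prob big_cons big_nil addr0 mulr1. Qed.

Definition repeat_tester k T := iter k (both T) accept_all.

Lemma repeat_tester_valid q k T :
  valid_tester q T -> valid_tester (k * q) (repeat_tester k T).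
Proof.
move=> HT; elim: k => [|k IH]; first exact: accept_all_valid.
by rewrite mulSn; apply: both_valid.
Qed.

Lemma acc_prob_repeat k T f : acc_prob (repeat_tester k T) f = acc_prob T f ^+ k.
Proof.
elim: k => [|k IH]; first exact: acc_prob_accept_all.
by rewrite /= acc_prob_both IH exprS.
Qed.

End Testers.

(* Bernoulli: [(1 - p) ^+ k * (1 + k p) <= ((1 - p) * (1 + p)) ^+ k <= 1]. *)
Lemma repeat_reject (R : realType) (p : R) k :
  0 <= p <= 1 -> 2 < k%:R * p -> (1 - p) ^+ k < 1 / 3.
Proof.
move=> /andP[p0 p1] kp.
have H : (1 - p) ^+ k * (1 + k%:R * p) <= 1.
  elim: k {kp} => [|k IH]; first by rewrite mul0r addr0 mulr1.
  have h0 : 0 <= (1 - p) ^+ k by apply: exprn_ge0; lra.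
  have k0 : 0 <= k%:R :> R by rewrite ler0n.
  apply: le_trans IH; rewrite exprS -natr1 mulrAC mulrC ler_wpM2l //.
  have : 0 <= k%:R * p * p by rewrite !mulr_ge0.
  have : 0 <= p * p by rewrite mulr_ge0.
  move: (k%:R) => c; nra.
have h0 : 0 <= (1 - p) ^+ k by apply: exprn_ge0; lra.
move: (k%:R * p) kp H h0 => c; move: ((1 - p) ^+ k) => z; nra.
Qed.

(** * One round of the tester *)

Section LineTester.
Variables (R : realType) (n d : nat) (l u : 'I_d -> nat -> R).
Variable D : 'I_d -> {ffun 'I_n -> R}.
Hypotheses (lu : bounding_family n l u) (D_distr : forall r, is_distr (D r)).
Variable T : 'I_d -> bst.
Hypothesis T_bst : forall r, bst_on n (T r).
Local Notation grid := (Defs.point n d).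

Definition ancestor r (v w : 'I_n) := (w : nat) \in proper_ancestors (T r) v.

Definition compatible r (v w : nat) (a b : R) :=
  (a - b <= qm1 l u r v w) && (b - a <= qm1 l u r w v).

Definition violates (f : grid -> R) r (x : grid) (w : 'I_n) :=
  ~~ compatible r (x r) w (f x) (f (upd x r w)).

Definition bad (f : grid -> R) r : pred grid :=
  [pred x : grid | [exists w, ancestor r (x r) w && violates f r x w]].

(** For ordered arguments [l < u] fixes which potential difference attains the maximum, and
    differences of one potential add up. *)
Lemma qm1_between r (a b c : nat) : (a < n)%N -> (c < n)%N ->
  (a <= b <= c)%N || (c <= b <= a)%N ->
  qm1 l u r a b + qm1 l u r b c <= qm1 l u r a c.
Proof.
move=> an cn abc.
have mono i j : (i <= j)%N -> (j < n)%N ->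
    \sum_(k < j) l r k - \sum_(k < i) l r k <= \sum_(k < j) u r k - \sum_(k < i) u r k.
  elim: j => [|j IH]; first by rewrite leqn0 => /eqP -> _; rewrite !subrr.
  rewrite leq_eqVlt => /orP[/eqP <-|]; first by rewrite !subrr.
  rewrite ltnS => ij jn; have := IH ij (ltnW jn); have := lu r jn.
  by rewrite !big_ord_recr /=; lra.
case/orP: abc => /andP[h1 h2].
  have := mono _ _ h1 (leq_ltn_trans h2 cn); have := mono _ _ h2 cn.
  by rewrite /qm1; minmax_lra.
have := mono _ _ h1 (leq_ltn_trans h2 an); have := mono _ _ h2 an.
by rewrite /qm1; minmax_lra.
Qed.

Lemma not_bad_line f r x y : ~~ bad f r x -> ~~ bad f r y -> line r x y ->
  f x - f y <= qm l u x y.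
Proof.
move=> xgood ygood xy; rewrite (qm_line _ _ xy).
(* The case [w = z r] is included because the common ancestor may be an endpoint. *)
have good_anc z w : ~~ bad f r z -> line r z x -> (w < n)%N ->
    w \in (z r : nat) :: proper_ancestors (T r) (z r) ->
    exists2 w' : 'I_n, w' = w :> nat & compatible r (z r) w (f z) (f (upd x r w')).
  move=> zgood zx wn; rewrite inE => /orP[/eqP ->|anc].
    exists (z r) => //; rewrite (lineE zx) upd_upd upd_id.
    by rewrite /compatible !subrr qm1_id lexx.
  exists (Ordinal wn) => //; move/existsPn: zgood => /(_ (Ordinal wn)).
  by rewrite /ancestor /violates /= anc /= negbK (lineE zx) upd_upd.
have sorted_T : pairwise ltn (inorder (T r)).
  by rewrite T_bst -(sorted_pairwise ltn_trans) iota_ltn_sorted.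
have in_T (i : 'I_n) : (i : nat) \in inorder (T r) by rewrite T_bst mem_iota /=.
have lift w : w \in (x r : nat) :: proper_ancestors (T r) (x r) -> (w < n)%N.
  by rewrite inE => /orP[/eqP ->//|/mem_proper_ancestors]; rewrite T_bst mem_iota.
have [w [w_between wx wy]] : exists w,
    [/\ (x r <= w <= y r)%N || (y r <= w <= x r)%N,
        w \in (x r : nat) :: proper_ancestors (T r) (x r)
      & w \in (y r : nat) :: proper_ancestors (T r) (y r)].
  have [le|/ltnW le] := leqP (x r) (y r).
    have [w [wb wx wy]] := common_ancestor sorted_T (in_T _) (in_T _) le.
    by exists w; rewrite wb.
  have [w [wb wy wx]] := common_ancestor sorted_T (in_T _) (in_T _) le.
  by exists w; rewrite wb orbT.
have wn := lift w wx.
have xx : line r x x by exact: eqOn_refl.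
have yx : line r y x by rewrite (lineE xy) upd_line.
have [w1 e1 /andP[c1 _]] := good_anc x w xgood xx wn wx.
have [w2 e2 /andP[_ c2]] := good_anc y w ygood yx wn wy.
have E : w2 = w1 by apply: val_inj; rewrite /= e1.
have := qm1_between r (ltn_ord (x r)) (ltn_ord (y r)) w_between.
by rewrite E in c2; lra.
Qed.

Local Notation event := ('I_d * grid * 'I_n)%type.
Definition is_event (i : event) := ancestor i.1.1 (i.1.2 i.1.1) i.2.

(** For [W > 0] this is [W] times the rejection probability of [line_tester W]. *)
Definition violation_mass (f : grid -> R) : R :=
  \sum_(i : event | is_event i) prodD D i.1.2 * (violates f i.1.1 i.1.2 i.2)%:R.

Lemma sum_events (F : event -> R) :
  \sum_(i : event | is_event i) F i =
  \sum_r \sum_(x : grid) \sum_(w | ancestor r (x r) w) F (r, x, w).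
Proof.
rewrite (pair_bigA _ (fun r (x : grid) => \sum_(w | ancestor r (x r) w) F (r, x, w))) /=.
rewrite pair_big_dep /=.
by apply: eq_big => [[[r x] w]|[[r x] w]].
Qed.

Lemma distP_violation_mass f : distP D l u f <= 8 * violation_mass f.
Proof.
apply: le_trans (_ : 8 * \sum_r \sum_(x | bad f r x) prodD D x <= _).
  apply: (@dimension_reduction _ _ _ l u D D_distr).
    by move=> r x y; exact: not_bad_line.
  move=> g Hg; apply: ge_inf; last by exists g => //; exact: good_inP.
  exists 0 => _ [g' _ <-]; apply: sumr_ge0 => x _; exact: prodD_ge0.
rewrite ler_wpM2l // /violation_mass sum_events.
apply: ler_sum => r _; rewrite big_mkcond; apply: ler_sum => x _.
case: ifP => [/existsP[w /andP[anc viol]]|_]; last first.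
  by apply: sumr_ge0 => w _; rewrite mulr_ge0 ?prodD_ge0.
(* A single violated ancestor already pays for the bad point. *)
rewrite (bigD1 w) //= viol mulr1 lerDl sumr_ge0 // => w' _.
by rewrite mulr_ge0 ?prodD_ge0.
Qed.

(** A point has at most as many events in direction [r] as the depth of its [r]-th coordinate, whose
    law is [D r]. *)
Lemma event_mass_le : \sum_(i : event | is_event i) prodD D i.1.2 <= \sum_r exp_depth (D r) (T r).
Proof.
rewrite sum_events; apply: ler_sum => r _ /=.
have -> : exp_depth (D r) (T r) = \sum_x prodD D x * (depth (T r) (x r))%:R.
  rewrite (resample D_distr r); apply: eq_bigr => a _; congr (_ * _).
  under eq_bigr do rewrite upd_same.
  by rewrite -mulr_suml sum_prodD // mul1r.
apply: ler_sum => x _; rewrite sumr_const -[_ *+ #|_|]mulr_natr ler_wpM2l ?prodD_ge0 // ler_nat.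
rewrite -size_proper_ancestors cardE -(size_map val); apply: uniq_leq_size.
  by rewrite (map_inj_uniq val_inj) enum_uniq.
by move=> _ /mapP[w + ->]; rewrite mem_enum.
Qed.

Definition pair_query (i : event) : qtree grid R :=
  QAsk i.1.2 (fun a => QAsk (upd i.1.2 i.1.1 i.2) (fun b =>
    QOut _ _ (compatible i.1.1 (i.1.2 i.1.1) i.2 a b))).

(** The head entry accepts without queries, with the probability left over by the events. *)
Definition line_tester (W : R) : rtester R n d :=
  (1 - W^-1 * \sum_(i : event | is_event i) prodD D i.1.2, QOut _ _ true) ::
  [seq (W^-1 * prodD D i.1.2, pair_query i) | i <- enum is_event].

Lemma line_tester_valid W : 0 < W -> \sum_r exp_depth (D r) (T r) <= W ->
  valid_tester 2 (line_tester W).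
Proof.
move=> W0 HW; split.
- move=> p [<-|H] /=; last have [i _ ->] := In_map H.
    rewrite subr_ge0 mulrC ler_pdivrMr // mul1r; exact: le_trans event_mass_le HW.
  by rewrite mulr_ge0 ?invr_ge0 ?prodD_ge0 // ltW.
- by rewrite big_cons big_map big_enum /= -mulr_sumr subrK.
- by move=> p [<-|H] //; have [i _ ->] := In_map H.
Qed.

Lemma acc_prob_line_tester W f :
  acc_prob (line_tester W) f = 1 - W^-1 * violation_mass f.
Proof.
rewrite /acc_prob big_cons big_map big_enum /= mulr1.
rewrite [X in _ + X](eq_bigr (fun i => W^-1 * prodD D i.1.2 -
  W^-1 * (prodD D i.1.2 * (violates f i.1.1 i.1.2 i.2)%:R))); last first.
  by move=> i _; rewrite /violates; case: compatible => /=; ring.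
by rewrite sumrB -!mulr_sumr /violation_mass; ring.
Qed.

Lemma violation_mass_inP f : inP l u f -> violation_mass f = 0.
Proof.
move=> Hf; rewrite /violation_mass big1 // => [[[r x] w]] _ /=.
have := inP_line Hf (line_upd x r w); rewrite (qm_line _ _ (line_upd x r w)) upd_same.
have := inP_line Hf (upd_line x r w); rewrite (qm_line _ _ (upd_line x r w)) upd_same.
by rewrite /violates /compatible => -> ->; rewrite mulr0.
Qed.

Lemma violation_mass_le f : violation_mass f <= \sum_r exp_depth (D r) (T r).
Proof.
apply: le_trans event_mass_le; apply: ler_sum => i _.
by rewrite ler_piMr ?prodD_ge0 //; case: violates.
Qed.

End LineTester.

Theorem theorem1p3 (R : realType) (n d : nat) (l u : 'I_d -> nat -> R)
  (D : 'I_d -> {ffun 'I_n -> R}) (eps : R) :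
  (1 <= n)%N -> (1 <= d)%N ->
  bounding_family n l u ->
  (forall r, is_distr (D r)) ->
  0 < eps ->
  exists (q : nat) (T : rtester R n d),
    [/\ q%:R <= 100 * eps^-1 * DeltaD D,
        valid_tester q T
      & is_tester D l u eps T].
Proof.
move=> _ _ lu D_distr eps0.
have /choice[T HT] r : exists t, bst_on n t /\ exp_depth (D r) t <= Delta1 (D r).
  by have [t ? ?] := optimal_bst (D r); exists t.
have T_bst r : bst_on n (T r) by case: (HT r).
pose W := DeltaD D.
have TW : \sum_r exp_depth (D r) (T r) <= W by apply: ler_sum => r _; case: (HT r).
have dist_le f : distP D l u f <= 8 * violation_mass l u D T f.
  exact: distP_violation_mass.
have mass_le f : violation_mass l u D T f <= W.
  by apply: le_trans TW; exact: violation_mass_le.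
(* If [W] vanishes, as for [n = 1], no function is far and no query is allowed. *)
have [W0|W0] := lerP W 0.
  exists 0%N, (accept_all R n d); split; last first.
  - split=> f; first by rewrite acc_prob_accept_all; lra.
    by move=> far; have := dist_le f; have := mass_le f; lra.
  - exact: accept_all_valid.
  - have : 0 <= W.
      apply: le_trans TW; apply: sumr_ge0 => r _; apply: sumr_ge0 => v _.
      by rewrite mulr_ge0 //; case: (D_distr r).
    by rewrite -/W => W0'; rewrite !mulr_ge0 // ?invr_ge0 ltW.
have c0 : 0 < W / eps by rewrite divr_gt0.
(* Each round makes two queries, so 50 [W / eps] rounds fit the budget. *)
pose k := Num.truncn (50 * (W / eps)).
have /andP[k_le k_gt] : k%:R <= 50 * (W / eps) < k.+1%:R.
  by apply: truncn_itv; lra.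
exists (k * 2)%N, (repeat_tester k (line_tester l u D T W)); split.
- by rewrite natrM -mulrA [_^-1 * _]mulrC -/W; lra.
- by apply: repeat_tester_valid; exact: line_tester_valid.
- split=> f; rewrite acc_prob_repeat acc_prob_line_tester.
    by move=> /violation_mass_inP ->; rewrite mulr0 subr0 expr1n; lra.
  move=> far; set p := W^-1 * _.
  have Wp : W * p = violation_mass l u D T f by rewrite /p mulrA divff ?mul1r ?gt_eqF.
  have p_gt : 1 < 8 * (W / eps) * p.
    have -> : 8 * (W / eps) * p = 8 * (W * p) / eps by ring.
    by rewrite ltr_pdivlMr // mul1r Wp; have := dist_le f; lra.
  have p1 : p <= 1 by rewrite -(ler_pM2l W0) mulr1 Wp mass_le.
  have p0 : 0 < p by rewrite -(pmulr_rgt0 _ W0) Wp; have := dist_le f; lra.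
  suff : (1 - p) ^+ k < 1 / 3 by lra.
  apply: repeat_reject; first by rewrite (ltW p0).
  (* Rounding down costs at most [p <= 1], so [k p > 50 / 8 - 1 > 2]. *)
  rewrite -[k.+1%:R]natr1 in k_gt.
  have : 50 * (W / eps) * p < (k%:R + 1) * p by rewrite ltr_pM2r.
  lra.
Qed.
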